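(* Fix a binary floating-point format with significand precision $p\ge2$, rounding to nearest with ties to even, and unit roundoff $u=2^{-p}$. Define $$s=\left\lceil\frac{p+2}{2}\right\rceil,\quad H=2^s,\quad h=H^{-1},\quad \epsilon_A=\frac{h^2u}{4}.$$ Assume that every nonzero exact intermediate result in the four Conjugate Gradient (CG) iterations and in the first two Lanczos steps described in the context is normal and finite. Consider the symmetric positive definite system $$A=\operatorname{diag}(\epsilon_A,1),\qquad b=(1,H)^T,\qquad x_0=0.$$ Initialize the Hestenes--Stiefel CG recurrence with $r_0=b$ and $p_0=r_0$, execute four CG iterations, taking all four updates before testing convergence, and denote the stored iterates by $x_j^{\rm cg}$. Then $$x_4^{\rm cg}=(\epsilon_A^{-1},H)^T=A^{-1}b .$$ Next, apply the Lanczos recurrence for two steps, and form the symmetric tridiagonal matrix $T_2^{\rm lan}$ from the stored recurrence coefficients. The stored initial coefficient and tridiagonal matrix are $$\beta_1^{\rm lan}=H,\qquad T_2^{\rm lan}=\begin{bmatrix} 1 & h \\ h & h^2 \end{bmatrix}.$$ The stored matrix is singular, and the projected Galerkin system $T_2^{\rm lan}y=\beta_1^{\rm lan}e_1=He_1$ is inconsistent. Thus CG stores the exact solution after four updates, while the direct projected equation at step two is singular and inconsistent.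
   Context: $p$ counts the bits of the binary significand including the leading bit. $\operatorname{fl}$ denotes rounding to nearest, ties to even; every scalar assignment and vector component is stored in the format before the next operation. Each elementary scalar operation (including square root) in a compound expression is rounded; products in vector updates are rounded before the addition or subtraction; matrix-vector products and inner products are accumulated from left to right (increasing component order). Exact zero results are allowed. $e_1=(1,0)^T$, $\langle x,y\rangle=x^Ty$. Hestenes--Stiefel CG recurrence: from $r_0$ and $p_0=r_0$, for $j=0,1,\dots$ $$q_j=\operatorname{fl}(Ap_j),\quad a_j^{\rm cg}=\operatorname{fl}\!\left(\frac{\operatorname{fl}(\langle r_j,r_j\rangle)}{\operatorname{fl}(\langle q_j,p_j\rangle)}\right),\quad x_{j+1}=\operatorname{fl}(x_j+a_j^{\rm cg}p_j),\quad r_{j+1}=\operatorname{fl}(r_j-a_j^{\rm cg}q_j),$$ $$b_{j+1}^{\rm cg}=\operatorname{fl}\!\left(\frac{\operatorname{fl}(\langle r_{j+1},r_{j+1}\rangle)}{\operatorname{fl}(\langle r_j,r_j\rangle)}\right),\quad p_{j+1}=\operatorname{fl}(r_{j+1}+b_{j+1}^{\rm cg}p_j).$$ Lanczos recurrence: $r_0=\operatorname{fl}(b-Ax_0)$, $v_0=0$, $\rho_0=\operatorname{fl}(\langle r_0,r_0\rangle)$, $\beta_1^{\rm lan}=\operatorname{fl}(\sqrt{\rho_0})$, $v_1=\operatorname{fl}(r_0/\beta_1^{\rm lan})$, and for $j=1,2,\dots$ $$q_j=\operatorname{fl}(Av_j),\quad w_j=\operatorname{fl}(q_j-\beta_j^{\rm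 lan}v_{j-1}),\quad \alpha_j^{\rm lan}=\operatorname{fl}(\langle v_j,w_j\rangle),\quad z_j=\operatorname{fl}(w_j-\alpha_j^{\rm lan}v_j),$$ $$\rho_j=\operatorname{fl}(\langle z_j,z_j\rangle),\quad \beta_{j+1}^{\rm lan}=\operatorname{fl}(\sqrt{\rho_j}),\quad v_{j+1}=\operatorname{fl}(z_j/\beta_{j+1}^{\rm lan}).$$ A zero $\beta_{j+1}^{\rm lan}$ ends the recurrence before the division. $T_2^{\rm lan}$ is the symmetric tridiagonal matrix with diagonal entries $\alpha_1^{\rm lan},\alpha_2^{\rm lan}$ and off-diagonal entry $\beta_2^{\rm lan}$. *)

(* Defs.v *)
From HB Require Import structures.
From mathcomp Require Import all_boot all_order all_algebra.
From mathcomp Require Import all_classical all_reals all_analysis.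

Set Implicit Arguments.
Unset Strict Implicit.
Unset Printing Implicit Defensive.

Import Order.TTheory GRing.Theory Num.Theory.
Local Open Scope ring_scope.

(* Binary format: finite values are k * 2 ^ (e - prec + 1) with
   |k| < 2 ^ prec and emin <= e <= emax (gradual underflow).  The two signed
   zeros are identified with the real number 0. *)
Record fp_format := FpFormat { prec : nat; emin : int; emax : int }.

Definition max_finite (R : realType) (f : fp_format) : R :=
  (2 - 2 ^ (1 - (prec f)%:Z)) * 2 ^ emax f.

Definition normal_finite (R : realType) (f : fp_format) (x : R) : Prop :=
  2 ^ emin f <= `|x| <= max_finite R f.

(* floor (log2 |x|); it is 0 at x = 0 since ln 0 = 0. *)
Definition binary_exponent (R : realType) (x : R) : int :=
  Num.floor (ln `|x| / ln 2).

(* Distance between consecutive floating-point numbers in the binade of x. *)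
Definition spacing (R : realType) (f : fp_format) (x : R) : R :=
  2 ^ (Num.max (emin f) (binary_exponent x) - (prec f)%:Z + 1).

Definition round_half_even (R : realType) (x : R) : int :=
  let n := Num.floor x in
  let d := x - n%:~R in
  if d < 2^-1 then n
  else if 2^-1 < d then n + 1
  else if odd `|n|%N then n + 1 else n.

(* None stands for overflow to an infinity. *)
Definition fl (R : realType) (f : fp_format) (x : R) : option R :=
  let y := (round_half_even (x / spacing f x))%:~R * spacing f x in
  if `|y| <= max_finite R f then Some y else None.

(* A floating-point computation: the exact (unrounded) result of each
   elementary operation in execution order, and the stored result, which is
   None after an overflow or an invalid operation. *)
Definition fpcomp (R : realType) (X : Type) : Type := (seq R * option X)%type.

Definition exact_results (R : realType) (X : Type) (m : fpcomp R X) : seq R :=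
  m.1.

Definition stored (R : realType) (X : Type) (m : fpcomp R X) : option X := m.2.

Definition ret (R : realType) (X : Type) (a : X) : fpcomp R X :=
  ([::], Some a).

Definition fpfail (R : realType) (X : Type) : fpcomp R X := ([::], None).

Definition bind (R : realType) (X Y : Type)
    (m : fpcomp R X) (k : X -> fpcomp R Y) : fpcomp R Y :=
  if m.2 is Some a then (m.1 ++ (k a).1, (k a).2) else (m.1, None).

Notation "'let*' x ':=' m 'in' k" := (bind m (fun x => k))
  (at level 200, x name, m at level 200, k at level 200, right associativity,
   format "'[v' 'let*'  x  ':='  m  'in' '/' k ']'").

Definition rnd (R : realType) (f : fp_format) (x : R) : fpcomp R R :=
  ([:: x], fl f x).

Definition fdiv (R : realType) (f : fp_format) (x y : R) : fpcomp R R :=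
  if y == 0 then fpfail R R else rnd f (x / y).

Definition fsqrt (R : realType) (f : fp_format) (x : R) : fpcomp R R :=
  if x < 0 then fpfail R R else rnd f (Num.sqrt x).

Definition vec2 (R : realType) (x y : R) : 'cV[R]_2 :=
  \col_(i < 2) (if i == 0 then x else y).

Definition mx2 (R : realType) (a b c d : R) : 'M[R]_2 :=
  \matrix_(i < 2, j < 2)
    (if i == 0 then (if j == 0 then a else b) else (if j == 0 then c else d)).

Definition vecM (R : realType) (g : 'I_2 -> fpcomp R R) : fpcomp R 'cV[R]_2 :=
  let* x := g 0 in
  let* y := g 1 in
  ret R (vec2 x y).

Definition finner (R : realType) (f : fp_format) (x y : 'cV[R]_2) :
    fpcomp R R :=
  let* s0 := rnd f (x 0 0 * y 0 0) in
  let* s1 := rnd f (x 1 0 * y 1 0) in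
  rnd f (s0 + s1).

Definition fmulmx (R : realType) (f : fp_format) (A : 'M[R]_2)
    (x : 'cV[R]_2) : fpcomp R 'cV[R]_2 :=
  vecM (fun i => finner f (row i A)^T x).

Definition fsubv (R : realType) (f : fp_format) (x y : 'cV[R]_2) :
    fpcomp R 'cV[R]_2 :=
  vecM (fun i => rnd f (x i 0 - y i 0)).

Definition faddZ (R : realType) (f : fp_format) (x : 'cV[R]_2) (a : R)
    (y : 'cV[R]_2) : fpcomp R 'cV[R]_2 :=
  vecM (fun i => let* t := rnd f (a * y i 0) in rnd f (x i 0 + t)).

Definition fsubZ (R : realType) (f : fp_format) (x : 'cV[R]_2) (a : R)
    (y : 'cV[R]_2) : fpcomp R 'cV[R]_2 :=
  vecM (fun i => let* t := rnd f (a * y i 0) in rnd f (x i 0 - t)).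

Definition fdivv (R : realType) (f : fp_format) (x : 'cV[R]_2) (a : R) :
    fpcomp R 'cV[R]_2 :=
  vecM (fun i => fdiv f (x i 0) a).

Record cg_state (R : realType) :=
  CgState { cg_x : 'cV[R]_2; cg_r : 'cV[R]_2; cg_p : 'cV[R]_2 }.

Definition cg_step (R : realType) (f : fp_format) (A : 'M[R]_2)
    (st : cg_state R) : fpcomp R (cg_state R) :=
  let: CgState x r p := st in
  let* q := fmulmx f A p in
  let* rr := finner f r r in
  let* qp := finner f q p in
  let* a := fdiv f rr qp in
  let* x' := faddZ f x a p in
  let* r' := fsubZ f r a q in
  let* rr' := finner f r' r' in
  let* b := fdiv f rr' rr in
  let* p' := faddZ f r' b p in
  ret R (CgState x' r' p').

(* n complete passes, without any stopping test. *)
Fixpoint cg (R : realType) (f : fp_format) (A : 'M[R]_2)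
    (x0 r0 : 'cV[R]_2) (n : nat) : fpcomp R (cg_state R) :=
  if n is n'.+1 then
    let* st := cg f A x0 r0 n' in cg_step f A st
  else ret R (CgState x0 r0 r0).

(* After j steps: [:: alpha_1; ...; alpha_j], [:: beta_1; ...; beta_(j+1)]
   and Some (v_j, v_(j+1)), or None when a zero beta has ended the
   recurrence. *)
Record lanczos_state (R : realType) := LanczosState {
  lan_alpha : seq R;
  lan_beta : seq R;
  lan_v : option ('cV[R]_2 * 'cV[R]_2) }.

Definition lanczos_init (R : realType) (f : fp_format) (A : 'M[R]_2)
    (b x0 : 'cV[R]_2) : fpcomp R (lanczos_state R) :=
  let* Ax0 := fmulmx f A x0 in
  let* r0 := fsubv f b Ax0 in
  let* rho0 := finner f r0 r0 in
  let* beta1 := fsqrt f rho0 in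
  if beta1 == 0 then ret R (LanczosState [::] [:: beta1] None)
  else
    let* v1 := fdivv f r0 beta1 in
    ret R (LanczosState [::] [:: beta1] (Some (0, v1))).

Definition lanczos_step (R : realType) (f : fp_format) (A : 'M[R]_2)
    (st : lanczos_state R) : fpcomp R (lanczos_state R) :=
  let: LanczosState alphas betas vs := st in
  if vs is Some (vprev, v) then
    let* q := fmulmx f A v in
    let* w := fsubZ f q (last 0 betas) vprev in
    let* alpha := finner f v w in
    let* z := fsubZ f w alpha v in
    let* rho := finner f z z in
    let* beta := fsqrt f rho in
    if beta == 0 then
      ret R (LanczosState (rcons alphas alpha) (rcons betas beta) None)
    else
      let* vnext := fdivv f z beta in
      ret R (LanczosState (rcons alphas alpha) (rcons betas beta)
               (Some (v, vnext)))
  else ret R st.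

Fixpoint lanczos (R : realType) (f : fp_format) (A : 'M[R]_2)
    (b x0 : 'cV[R]_2) (n : nat) : fpcomp R (lanczos_state R) :=
  if n is n'.+1 then
    let* st := lanczos f A b x0 n' in lanczos_step f A st
  else lanczos_init f A b x0.

Definition lanczos_T2 (R : realType) (st : lanczos_state R) : 'M[R]_2 :=
  mx2 (lan_alpha st)`_0 (lan_beta st)`_1
      (lan_beta st)`_1  (lan_alpha st)`_1.

Definition spd (R : realType) (n : nat) (A : 'M[R]_n) : Prop :=
  A^T = A /\ forall x : 'cV[R]_n, x != 0 -> 0 < (x^T *m A *m x) 0 0.

(* Main.v *)
(* Every exact intermediate result is zero or a power of two up to sign and up
   to a relative perturbation of at most u/4, because h^2 <= u/4.  Such a number
   rounds to that power of two, so the stored values can be followed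
   symbolically.  With e = epsA, the CG states (x, r, p) are
     ((0, 0), (1, H), (1, H)),          ((1, H), (1, 0), (1, h)),
     ((H^2, 2H), (1, -H), (H^2, 0)),    ((1/e, 2H), (0, -H), (H^2, -H)),
     ((1/e, H), (-u/4, 0), (-u/4, -u^2/(16H))),
   and the Lanczos vectors are v_1 = (h, 1), v_2 = (-1, 0), v_3 = (0, -1). *)
Require Import Defs.
From mathcomp Require Import all_boot all_order all_algebra.
From mathcomp Require Import all_classical all_reals all_analysis.
From mathcomp Require Import ring lra zify.

Set Implicit Arguments.
Unset Strict Implicit.
Unset Printing Implicit Defensive.

Import Order.TTheory GRing.Theory Num.Theory.
Local Open Scope ring_scope.

(** * Exponents and rounding to nearest *)

Lemma ln_exprz (R : realType) (x : R) (k : int) :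
  0 < x -> ln (x ^ k) = k%:~R * ln x.
Proof.
move=> x0; case: k => n; first by rewrite -exprnP lnXn// mulr_natl.
by rewrite NegzE -exprnN lnV ?posrE ?exprn_gt0// lnXn// mulrNz mulNr mulr_natl.
Qed.

(** The strict bound excludes ties, so the parity test is never reached. *)
Lemma round_half_even_eq (R : realType) (x : R) (n : int) :
  `|x - n%:~R| < 2^-1 -> round_half_even x = n.
Proof.
rewrite ltr_norml => /andP[xl xu]; rewrite /round_half_even.
have [nx|xn] := leP n%:~R x.
  have -> : Num.floor x = n by apply: floor_def; rewrite nx rmorphD/=; lra.
  by rewrite xu.
have -> : Num.floor x = n - 1.
  by apply: floor_def; rewrite subrK xn andbT rmorphB/=; lra.
have d_gt : 2^-1 < x - (n - 1)%:~R by rewrite rmorphB/=; lra.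
by rewrite (lt_gtF d_gt) d_gt subrK.
Qed.

Lemma binary_exponent_eq (R : realType) (x : R) (e : int) :
  2 ^ e <= `|x| < 2 ^ (e + 1) -> binary_exponent x = e.
Proof.
move=> /andP[ex xe]; have e_gt0 k : 0 < (2 : R) ^ k by rewrite exprz_gt0.
have x_gt0 : 0 < `|x| by apply: lt_le_trans ex.
have ln2_gt0 : 0 < ln (2 : R) by rewrite ln_gt0// ltr1n.
apply: floor_def; rewrite ler_pdivlMr// ltr_pdivrMr// -!ln_exprz//.
by rewrite ler_ln ?posrE// ltr_ln ?posrE// ex xe.
Qed.

Lemma max_finite_ge0 (R : realType) (f : fp_format) :
  (0 < prec f)%N -> 0 <= max_finite R f.
Proof.
move=> p0; rewrite mulr_ge0 ?exprz_ge0// subr_ge0.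
have -> : (2 : R) = 2 ^ (1 : int) by [].
by rewrite ler_eXz2l ?ltr1n//; lia.
Qed.

(** The lower bound on the absolute value of [x] forces [emin f <= e], so the spacing is that of the
    binade and not that of the subnormal range. Rounding [x] then amounts to rounding [x / ulp] to
    an integer. *)
Lemma fl_eq (R : realType) (f : fp_format) (x : R) (e n : int) :
    let ulp := (2 : R) ^ (e - (prec f)%:Z + 1) in
    2 ^ emin f <= `|x| -> 2 ^ e <= `|x| < 2 ^ (e + 1) ->
    `|x - n%:~R * ulp| < ulp / 2 -> `|n%:~R * ulp| <= max_finite R f ->
  fl f x = Some (n%:~R * ulp).
Proof.
move=> ulp x_normal xe x_near n_finite.
have emin_e : emin f <= e.
  have /andP[_ xe1] := xe; have := le_lt_trans x_normal xe1.
  by rewrite ltr_eXz2l ?ltr1n// ltzD1.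
have ulpE : spacing f x = ulp.
  by rewrite /spacing (binary_exponent_eq xe) max_r.
have ulp_gt0 : 0 < ulp by rewrite exprz_gt0.
rewrite /fl ulpE (_ : round_half_even _ = n) ?n_finite//.
apply: round_half_even_eq.
have -> : x / ulp - n%:~R = (x - n%:~R * ulp) / ulp.
  by rewrite mulrBl mulfK ?gt_eqF.
by rewrite normrM normfV (gtr0_norm ulp_gt0) ltr_pdivrMr// (mulrC 2^-1).
Qed.

Lemma fl0 (R : realType) (f : fp_format) :
  (0 < prec f)%N -> fl f 0 = Some (0 : R).
Proof.
move=> p0; rewrite /fl mul0r (@round_half_even_eq _ _ 0).
  by rewrite mul0r normr0 max_finite_ge0.
by rewrite subrr normr0; lra.
Qed.

(** * Powers of two and small relative perturbations *)

Definition pow2_or_0 (R : realType) (x : R) : Prop :=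
  x = 0 \/ exists k : int, `|x| = 2 ^ k.

Lemma pow2_or_00 (R : realType) : pow2_or_0 (0 : R).
Proof. by left. Qed.

Lemma pow2_or_0X (R : realType) (n : nat) : pow2_or_0 (2 ^+ n : R).
Proof. by right; exists n; rewrite ger0_norm. Qed.

Lemma pow2_or_01 (R : realType) : pow2_or_0 (1 : R).
Proof. exact: (pow2_or_0X R 0). Qed.

Lemma pow2_or_0N (R : realType) (x : R) : pow2_or_0 x -> pow2_or_0 (- x).
Proof.
case=> [->|[k kE]]; first by left; rewrite oppr0.
by right; exists k; rewrite normrN.
Qed.

Lemma pow2_or_0V (R : realType) (x : R) : pow2_or_0 x -> pow2_or_0 x^-1.
Proof.
case=> [->|[k kE]]; first by left; rewrite invr0.
by right; exists (- k); rewrite normfV kE invr_expz.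
Qed.

Lemma pow2_or_0M (R : realType) (x y : R) :
  pow2_or_0 x -> pow2_or_0 y -> pow2_or_0 (x * y).
Proof.
case=> [->|[k kE]]; first by left; rewrite mul0r.
case=> [->|[l lE]]; first by left; rewrite mulr0.
by right; exists (k + l); rewrite normrM kE lE expfzDr ?pnatr_eq0.
Qed.

Lemma pow2_or_0_exp (R : realType) (x : R) (n : nat) :
  pow2_or_0 x -> pow2_or_0 (x ^+ n).
Proof.
move=> x2; elim: n => [|n IHn]; first by rewrite expr0; exact: pow2_or_01.
by rewrite exprS; apply: pow2_or_0M.
Qed.

(* A quarter of the unit roundoff is below half the spacing on either side of
   a power of two, so that [x] rounds to [y] whatever the signs. *)
Definition near_pow2 (R : realType) (p : nat) (x y : R) : Prop :=
  pow2_or_0 y /\ `|x - y| <= 2 ^- p / 4 * `|y|.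

(** The spacing halves just below a power of two, so the two sides are treated apart. Normality is
    assumed of [x] alone; that [y] does not overflow has to be derived from it. *)
Lemma fl_near_pow2 (R : realType) (f : fp_format) (x y : R) :
    (2 <= prec f)%N -> near_pow2 (prec f) x y ->
    (x != 0 -> normal_finite f x) ->
  fl f x = Some y.
Proof.
move=> p2 [[->|[k yE]] xy] x_normal.
  move: xy; rewrite normr0 mulr0 subr0 normr_le0 => /eqP ->.
  by rewrite fl0// (leq_trans _ p2).
set p := prec f in p2 xy; set u : R := 2 ^- p in xy.
have k_gt0 : 0 < (2 : R) ^ k by rewrite exprz_gt0.
have u_gt0 : 0 < u by rewrite invr_gt0 exprn_gt0.
have u_le : u <= 1 / 4.
  have -> : 1 / 4 = (2 : R) ^- 2 by rewrite div1r expr2 -natrM.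
  by rewrite lef_pV2 ?posrE ?exprn_gt0// ler_eXn2l ?ltr1n.
rewrite yE in xy.
have lower : (1 - u / 4) * 2 ^ k <= `|x|.
  by have := ler_distD x y 0; rewrite !subr0 yE (distrC y x); lra.
have upper : `|x| <= (1 + u / 4) * 2 ^ k.
  by have := ler_distD y x 0; rewrite !subr0 yE; lra.
have x_neq0 : x != 0 by rewrite -normr_gt0 (lt_le_trans _ lower)//; nra.
have /andP[x_emin x_max] := x_normal x_neq0.
(* Splitting off the sign exhibits [y] as an integer multiple of the spacing for both signs at
   once. *)
have ySg : y = Num.sg y * 2 ^ k by rewrite -yE -numEsg.
have kS : (2 : R) ^ (k + 1) = 2 * 2 ^ k by rewrite expfzDr ?pnatr_eq0// mulrC.
have kP : (2 : R) ^ (k - 1) = 2 ^ k / 2 by rewrite expfzDr ?pnatr_eq0.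
(* At or above 2^k the spacing is 2u 2^k, so [y] has the smallest normal significand 2^(p-1), and
   the error u 2^k / 4 is below half the spacing. *)
have [kx|xk] := leP (2 ^ k) `|x|.
  have ulpE : (2 : R) ^ (k - p%:Z + 1) = 2 * u * 2 ^ k.
    by rewrite !expfzDr ?pnatr_eq0// /u exprnN; ring.
  have nE : (sgz y * 2 ^+ p.-1)%:~R * 2 ^ (k - p%:Z + 1) = y.
    rewrite [RHS]ySg sgrEz rmorphM rmorphXn/= -mulrA ulpE; congr (_ * _).
    rewrite -[in RHS](mul1r (2 ^ k)) !mulrA; congr (_ * _).
    by rewrite -exprSr prednK ?(leq_trans _ p2)// divff// expf_neq0// pnatr_eq0.
  rewrite -[in RHS]nE; apply: fl_eq => //; rewrite -/p ?nE.
  - rewrite kx kS; nra.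
  - rewrite ulpE; nra.
  - by rewrite yE (le_trans kx).
(* Below 2^k the exponent is k - 1 and the spacing u 2^k. Here [y] is 2^p spacings, one past the
   largest significand of the binade, and the error is at most a quarter of the spacing. *)
have ulpE : (2 : R) ^ (k - 1 - p%:Z + 1) = u * 2 ^ k.
  by rewrite addrAC subrK expfzDr ?pnatr_eq0// mulrC /u exprnN.
have nE : (sgz y * 2 ^+ p)%:~R * 2 ^ (k - 1 - p%:Z + 1) = y.
  rewrite [RHS]ySg sgrEz rmorphM rmorphXn/= -mulrA ulpE; congr (_ * _).
  by rewrite mulrA divff ?mul1r// expf_neq0// pnatr_eq0.
rewrite -[in RHS]nE; apply: fl_eq => //; rewrite -/p ?nE.
- rewrite subrK xk kP andbT; nra.
- rewrite ulpE; nra.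
(* Now [y] exceeds [x] in magnitude, so its finiteness is not inherited. If k > emax, then (1 - u/4)
   2^(emax+1) is already larger than the greatest finite number (1 - u) 2^(emax+1), contradicting
   the bound on [x]. *)
rewrite yE /max_finite.
have -> : (2 : R) ^ (1 - (prec f)%:Z) = 2 * u.
  by rewrite expfzDr ?pnatr_eq0// /u exprnN.
have emax_gt0 : 0 < (2 : R) ^ emax f by rewrite exprz_gt0.
have [kle|] := leP k (emax f).
  have : (2 : R) ^ k <= 2 ^ emax f by rewrite ler_eXz2l ?ltr1n.
  by nra.
rewrite -lezD1 => kge.
have : (2 : R) ^ (emax f + 1) <= 2 ^ k by rewrite ler_eXz2l ?ltr1n.
rewrite expfzDr ?pnatr_eq0// => {}kge.
move: x_max; rewrite /max_finite.
have -> : (2 : R) ^ (1 - (prec f)%:Z) = 2 * u.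
  by rewrite expfzDr ?pnatr_eq0// /u exprnN.
move=> x_max; nra.
Qed.

Lemma near_pow2_refl (R : realType) (p : nat) (x : R) :
  pow2_or_0 x -> near_pow2 p x x.
Proof.
move=> x2; split=> //; rewrite subrr normr0.
by rewrite mulr_ge0// divr_ge0// invr_ge0 exprn_ge0.
Qed.

(** With the relative error [c] given explicitly, a rounding check splits into a field identity and
    a bound on [c]. *)
Lemma near_pow2_perturb (R : realType) (p : nat) (x y c : R) :
  pow2_or_0 y -> x = y * (1 + c) -> `|c| <= 2 ^- p / 4 -> near_pow2 p x y.
Proof.
move=> y2 -> c_small; split=> //.
have -> : y * (1 + c) - y = c * y by ring.
by rewrite normrM ler_wpM2r.
Qed.

(** * Symbolic execution of floating-point computations *)

(** Normality is a premise of the judgement itself: since [bind] concatenates the exact results, the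
    assumption on a whole run restricts to each of its operations. *)
Definition computes (R : realType) (f : fp_format) (X : Type)
    (m : fpcomp R X) (a : X) : Prop :=
  (forall x, x \in exact_results m -> x != 0 -> normal_finite f x) ->
  stored m = Some a.

Lemma computes_ret (R : realType) (f : fp_format) (X : Type) (a : X) :
  computes f (ret R a) a.
Proof. by []. Qed.

Lemma computes_bind (R : realType) (f : fp_format) (X Y : Type)
    (m : fpcomp R X) (k : X -> fpcomp R Y) (a : X) (c : Y) :
  computes f m a -> computes f (k a) c -> computes f (bind m k) c.
Proof.
case: m => [xs [a'|]]; rewrite /computes /bind /exact_results /stored /=.
  move=> ma kc normal; have [] : Some a' = Some a.
    by apply: ma => x xin; apply: normal; rewrite mem_cat xin.
  move=> aE; rewrite aE in normal *.
  by apply: kc => x xin; apply: normal; rewrite mem_cat xin orbT.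
(* A failing [m] cannot store [a], so this case contradicts the judgement on [m]. *)
by move=> ma _ /ma.
Qed.

Lemma computes_rnd (R : realType) (f : fp_format) (x y : R) :
  (2 <= prec f)%N -> near_pow2 (prec f) x y -> computes f (rnd f x) y.
Proof.
move=> p2 xy normal; apply: fl_near_pow2 => // x0.
by apply: normal x0; rewrite mem_head.
Qed.

Lemma computes_fdiv (R : realType) (f : fp_format) (x y z : R) :
    (2 <= prec f)%N -> y != 0 -> near_pow2 (prec f) (x / y) z ->
  computes f (fdiv f x y) z.
Proof. by move=> p2 /negPf y0 xy; rewrite /fdiv y0; apply: computes_rnd. Qed.

Lemma computes_fsqrt (R : realType) (f : fp_format) (x y : R) :
    (2 <= prec f)%N -> 0 <= y -> pow2_or_0 y -> x = y ^+ 2 ->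
  computes f (fsqrt f x) y.
Proof.
move=> p2 y0 y2 ->; rewrite /fsqrt ltNge sqr_ge0 sqrtr_sqr ger0_norm//.
exact/computes_rnd/near_pow2_refl.
Qed.

Lemma vec2E (R : realType) (x y : R) : (vec2 x y 0 0 = x) * (vec2 x y 1 0 = y).
Proof. by rewrite /vec2 !mxE. Qed.

Lemma vec2_00 (R : realType) : vec2 0 0 = 0 :> 'cV[R]_2.
Proof. by apply/colP => i; rewrite !mxE; case: ifP. Qed.

Lemma row_mx2T (R : realType) (a b c d : R) :
  ((row 0 (mx2 a b c d))^T = vec2 a b) * ((row 1 (mx2 a b c d))^T = vec2 c d).
Proof. by split; apply/colP => i; rewrite !mxE. Qed.

Lemma computes_vecM (R : realType) (f : fp_format) (g : 'I_2 -> fpcomp R R)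
    (x y : R) :
  computes f (g 0) x -> computes f (g 1) y -> computes f (vecM g) (vec2 x y).
Proof.
by move=> gx gy; apply: computes_bind gx _; apply: computes_bind gy _.
Qed.

(** Products of powers of two are stored exactly, so only the final sum can carry an error. *)
Lemma computes_finner (R : realType) (f : fp_format) (a b c d s : R) :
    (2 <= prec f)%N ->
    pow2_or_0 a -> pow2_or_0 b -> pow2_or_0 c -> pow2_or_0 d ->
    near_pow2 (prec f) (a * c + b * d) s ->
  computes f (finner f (vec2 a b) (vec2 c d)) s.
Proof.
move=> p2 a2 b2 c2 d2 sE; rewrite /finner !vec2E.
have prod_exact (x y : R) : pow2_or_0 x -> pow2_or_0 y ->
    computes f (rnd f (x * y)) (x * y).
  by move=> x2 y2; apply/computes_rnd/near_pow2_refl/pow2_or_0M.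
apply: computes_bind (prod_exact _ _ a2 c2) _.
apply: computes_bind (prod_exact _ _ b2 d2) _.
exact: computes_rnd.
Qed.

(** The off-diagonal products are exact zeros, so no rounding error occurs. The variables [dx] and
    [ey] let the caller supply the products in simplified form. *)
Lemma computes_fmulmx_diag (R : realType) (f : fp_format)
    (d e x y dx ey : R) :
    (2 <= prec f)%N ->
    pow2_or_0 d -> pow2_or_0 e -> pow2_or_0 x -> pow2_or_0 y ->
    dx = d * x -> ey = e * y ->
  computes f (fmulmx f (mx2 d 0 0 e) (vec2 x y)) (vec2 dx ey).
Proof.
move=> p2 d2 e2 x2 y2 -> ->; have z2 := pow2_or_00 R.
apply: computes_vecM; rewrite row_mx2T; apply: computes_finner => //.
  by rewrite mul0r addr0; apply/near_pow2_refl/pow2_or_0M.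
by rewrite mul0r add0r; apply/near_pow2_refl/pow2_or_0M.
Qed.

Lemma computes_fsubv (R : realType) (f : fp_format) (a b c d x y : R) :
    (2 <= prec f)%N ->
    near_pow2 (prec f) (a - c) x -> near_pow2 (prec f) (b - d) y ->
  computes f (fsubv f (vec2 a b) (vec2 c d)) (vec2 x y).
Proof.
by move=> p2 ac bd; apply: computes_vecM; rewrite !vec2E; apply: computes_rnd.
Qed.

Lemma computes_faddZ (R : realType) (f : fp_format) (a b t c d x y : R) :
    (2 <= prec f)%N -> pow2_or_0 t -> pow2_or_0 c -> pow2_or_0 d ->
    near_pow2 (prec f) (a + t * c) x -> near_pow2 (prec f) (b + t * d) y ->
  computes f (faddZ f (vec2 a b) t (vec2 c d)) (vec2 x y).
Proof.
move=> p2 t2 c2 d2 ax bx; apply: computes_vecM; rewrite !vec2E.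
  apply: computes_bind (computes_rnd p2 (near_pow2_refl _ (pow2_or_0M t2 c2))) _.
  exact: computes_rnd.
apply: computes_bind (computes_rnd p2 (near_pow2_refl _ (pow2_or_0M t2 d2))) _.
exact: computes_rnd.
Qed.

Lemma computes_fsubZ (R : realType) (f : fp_format) (a b t c d x y : R) :
    (2 <= prec f)%N -> pow2_or_0 t -> pow2_or_0 c -> pow2_or_0 d ->
    near_pow2 (prec f) (a - t * c) x -> near_pow2 (prec f) (b - t * d) y ->
  computes f (fsubZ f (vec2 a b) t (vec2 c d)) (vec2 x y).
Proof.
move=> p2 t2 c2 d2 ax bx; apply: computes_vecM; rewrite !vec2E.
  apply: computes_bind (computes_rnd p2 (near_pow2_refl _ (pow2_or_0M t2 c2))) _.
  exact: computes_rnd.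
apply: computes_bind (computes_rnd p2 (near_pow2_refl _ (pow2_or_0M t2 d2))) _.
exact: computes_rnd.
Qed.

Lemma computes_fdivv (R : realType) (f : fp_format) (a b t x y : R) :
    (2 <= prec f)%N -> t != 0 ->
    near_pow2 (prec f) (a / t) x -> near_pow2 (prec f) (b / t) y ->
  computes f (fdivv f (vec2 a b) t) (vec2 x y).
Proof.
by move=> p2 t0 ax bx; apply: computes_vecM; rewrite !vec2E; apply: computes_fdiv.
Qed.

(** * One step of each recurrence *)

Lemma computes_cg_step (R : realType) (f : fp_format) (A : 'M[R]_2)
    (x r p q x' r' p' : 'cV[R]_2) (rr qp a rr' b : R) :
    computes f (fmulmx f A p) q -> computes f (finner f r r) rr ->
    computes f (finner f q p) qp -> computes f (fdiv f rr qp) a ->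
    computes f (faddZ f x a p) x' -> computes f (fsubZ f r a q) r' ->
    computes f (finner f r' r') rr' -> computes f (fdiv f rr' rr) b ->
    computes f (faddZ f r' b p) p' ->
  computes f (cg_step f A (CgState x r p)) (CgState x' r' p').
Proof.
move=> sq srr sqp sa sx sr srr' sb sp; rewrite /cg_step.
apply: (computes_bind sq); apply: (computes_bind srr).
apply: (computes_bind sqp); apply: (computes_bind sa).
apply: (computes_bind sx); apply: (computes_bind sr).
apply: (computes_bind srr'); apply: (computes_bind sb).
exact: (computes_bind sp).
Qed.

Lemma computes_lanczos_step (R : realType) (f : fp_format) (A : 'M[R]_2)
    (alphas betas : seq R) (vprev v q w z vnext : 'cV[R]_2)
    (alpha rho beta : R) :
    computes f (fmulmx f A v) q ->
    computes f (fsubZ f q (last 0 betas) vprev) w ->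
    computes f (finner f v w) alpha -> computes f (fsubZ f w alpha v) z ->
    computes f (finner f z z) rho -> computes f (fsqrt f rho) beta ->
    beta != 0 -> computes f (fdivv f z beta) vnext ->
  computes f (lanczos_step f A (LanczosState alphas betas (Some (vprev, v))))
    (LanczosState (rcons alphas alpha) (rcons betas beta) (Some (v, vnext))).
Proof.
move=> sq sw salpha sz srho sbeta /negPf beta0 sv; rewrite /lanczos_step.
apply: (computes_bind sq); apply: (computes_bind sw).
apply: (computes_bind salpha); apply: (computes_bind sz).
apply: (computes_bind srho); apply: (computes_bind sbeta); rewrite beta0.
exact: (computes_bind sv).
Qed.

(** * Automation of the rounding checks *)

Ltac pow2 := repeat first
  [ assumption | apply: pow2_or_00 | apply: pow2_or_01
  | apply: pow2_or_0N | apply: pow2_or_0V | apply: pow2_or_0_exp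
  | apply: pow2_or_0M ].

Ltac nonzero := repeat first
  [ done | rewrite oner_eq0 | rewrite pnatr_eq0 //
  | apply: expf_neq0 | rewrite oppr_eq0 | rewrite invr_eq0 | apply: mulf_neq0 ].

Ltac by_field := field; repeat (apply/andP; split); nonzero.

(** The last alternative unfolds the local definition of epsA, for identities that depend on its
    value. *)
Ltac algebra := first
  [ ring | by_field
  | match goal with e := _ * _ |- _ => rewrite /e; by_field end ].

(** The argument is the relative error of the exact result; its bound is expected among the
    hypotheses. *)
Ltac rounds c :=
  apply: (near_pow2_perturb (c := c)); [pow2 | algebra | assumption].

(** For k = h^2 these are, up to sign, all the relative errors met in the two runs. *)
Lemma small_perturbations (R : realType) (u k : R) :
    0 <= u -> u <= 1 -> 0 <= k -> k <= u / 4 -> let e := k * u / 4 in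
  [/\ `|0 : R| <= u / 4, `|k| <= u / 4, `|e * k| <= u / 4,
      `|- e| <= u / 4 & `|u / 4| <= u / 4].
Proof.
move=> u_ge0 u_le1 k_ge0 k_le e.
have e_ge0 : 0 <= e by rewrite /e; nra.
have e_le : e <= u / 4 by rewrite /e; nra.
split; rewrite ?normr0 ?normrN ?ger0_norm//; try lra; last exact: mulr_ge0.
by apply: le_trans e_le; apply: ler_piMr => //; lra.
Qed.

(** * The four conjugate gradient updates *)

(** The key relation is e H^2 = u/4. The second update overshoots the second component to 2H; the
    third brings the first component to 1/e, and the fourth restores H while its change H^2 to 1/e
    is lost in rounding. *)
Lemma computes_cg4 (R : realType) (f : fp_format) (H : R) :
    let u : R := 2 ^- prec f in let e := H^-1 ^+ 2 * u / 4 in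
    (2 <= prec f)%N -> 0 < H -> pow2_or_0 H -> H^-1 ^+ 2 <= u / 4 ->
  computes f (cg f (mx2 e 0 0 1) (vec2 0 0) (vec2 1 H) 4)
    (CgState (vec2 e^-1 H) (vec2 (- (u / 4)) 0)
       (vec2 (- (u / 4)) (- (u ^+ 2 / 16 / H)))).
Proof.
move=> u e p2 H_gt0 H2 h_le.
have u2 : pow2_or_0 u by apply/pow2_or_0V/pow2_or_0X.
have two2 : pow2_or_0 (2 : R) := pow2_or_0X R 1.
have four2 : pow2_or_0 (4 : R) by rewrite (_ : 4 = 2 ^+ 2 :> R); [pow2|ring].
have sixteen2 : pow2_or_0 (16 : R).
  by rewrite (_ : 16 = 2 ^+ 4 :> R); [pow2|ring].
have H0 : H != 0 by rewrite gt_eqF.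
have u_gt0 : 0 < u by rewrite invr_gt0 exprn_gt0.
have u0 : u != 0 by rewrite gt_eqF.
have u_le1 : u <= 1 by rewrite invf_le1 ?exprn_gt0// exprn_ege1// ler1n.
have h_ge0 : 0 <= H^-1 ^+ 2 by rewrite sqr_ge0.
have [small0 small_h small_eh small_Ne small_u] :=
  small_perturbations (ltW u_gt0) u_le1 h_ge0 h_le.
have small_Nu : `|- (u / 4)| <= u / 4 by rewrite normrN.
have e2 : pow2_or_0 e by rewrite /e; pow2.
have e0 : e != 0 by rewrite /e; nonzero.
(* The outermost [bind] is the last update, so the intermediate states are given from the third back
   to the initial one. *)
apply: (computes_bind (a := CgState (vec2 e^-1 (2 * H)) (vec2 0 (- H))
  (vec2 (H ^+ 2) (- H)))).
apply: (computes_bind (a := CgState (vec2 (H ^+ 2) (2 * H)) (vec2 1 (- H))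
  (vec2 (H ^+ 2) 0))).
apply: (computes_bind (a := CgState (vec2 1 H) (vec2 1 0) (vec2 1 H^-1))).
apply: (computes_bind (a := CgState (vec2 0 0) (vec2 1 H) (vec2 1 H))).
exact: computes_ret.
- apply: (@computes_cg_step _ _ _ _ _ _ (vec2 e H) _ _ _ (H ^+ 2) (H ^+ 2) 1
    1 (H^-1 ^+ 2)).
  + by apply: computes_fmulmx_diag; try done; try pow2; algebra.
  + by apply: computes_finner; try done; try pow2; rounds (H^-1 ^+ 2).
  + by apply: computes_finner; try done; try pow2; rounds (e * H^-1 ^+ 2).
  + apply: computes_fdiv; [by []|nonzero|rounds (0 : R)].
  + by apply: computes_faddZ; try done; try pow2;
      [rounds (0 : R)|rounds (0 : R)].
  + by apply: computes_fsubZ; try done; try pow2;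
      [rounds (- e)|rounds (0 : R)].
  + by apply: computes_finner; try done; try pow2; rounds (0 : R).
  + apply: computes_fdiv; [by []|nonzero|rounds (0 : R)].
  + by apply: computes_faddZ; try done; try pow2;
      [rounds (H^-1 ^+ 2)|rounds (0 : R)].
(* The curvature e + h^2 = h^2 (1 + u/4) loses e, which gives the step length H^2; the first
   residual component 1 - e H^2 = 1 - u/4 is then stored as 1. *)
- apply: (@computes_cg_step _ _ _ _ _ _ (vec2 e H^-1) _ _ _ 1 (H^-1 ^+ 2)
    (H ^+ 2) (H ^+ 2) (H ^+ 2)).
  + by apply: computes_fmulmx_diag; try done; try pow2; algebra.
  + by apply: computes_finner; try done; try pow2; rounds (0 : R).
  + by apply: computes_finner; try done; try pow2; rounds (u / 4).
  + apply: computes_fdiv; [by []|nonzero|rounds (0 : R)].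
  + by apply: computes_faddZ; try done; try pow2;
      [rounds (H^-1 ^+ 2)|rounds (0 : R)].
  + by apply: computes_fsubZ; try done; try pow2;
      [rounds (- (u / 4))|rounds (0 : R)].
  + by apply: computes_finner; try done; try pow2; rounds (H^-1 ^+ 2).
  + apply: computes_fdiv; [by []|nonzero|rounds (0 : R)].
  + by apply: computes_faddZ; try done; try pow2;
      [rounds (H^-1 ^+ 2)|rounds (0 : R)].
(* The step length 4/u cancels the first residual component exactly, and H^2 + 4 H^2 / u = (1/e)(1 +
   u/4) is stored as 1/e. *)
- apply: (@computes_cg_step _ _ _ _ _ _ (vec2 (u / 4) 0) _ _ _ (H ^+ 2)
    (u / 4 * H ^+ 2) (4 / u) (H ^+ 2) 1).
  + by apply: computes_fmulmx_diag; try done; try pow2; algebra.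
  + by apply: computes_finner; try done; try pow2; rounds (H^-1 ^+ 2).
  + by apply: computes_finner; try done; try pow2; rounds (0 : R).
  + apply: computes_fdiv; [by []|nonzero|rounds (0 : R)].
  + by apply: computes_faddZ; try done; try pow2;
      [rounds (u / 4)|rounds (0 : R)].
  + by apply: computes_fsubZ; try done; try pow2;
      [rounds (0 : R)|rounds (0 : R)].
  + by apply: computes_finner; try done; try pow2; rounds (0 : R).
  + apply: computes_fdiv; [by []|nonzero|rounds (0 : R)].
  + by apply: computes_faddZ; try done; try pow2;
      [rounds (0 : R)|rounds (0 : R)].
(* The curvature H^2 (1 + u/4) is stored as H^2, so the step length is 1: the second component
   becomes 2H - H, and 1/e + H^2 = (1/e)(1 + u/4) is stored as 1/e. *)
- apply: (@computes_cg_step _ _ _ _ _ _ (vec2 (u / 4) (- H)) _ _ _ (H ^+ 2)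
    (H ^+ 2) 1 (u ^+ 2 / 16) (u ^+ 2 / 16 / H ^+ 2)).
  + by apply: computes_fmulmx_diag; try done; try pow2; algebra.
  + by apply: computes_finner; try done; try pow2; rounds (0 : R).
  + by apply: computes_finner; try done; try pow2; rounds (u / 4).
  + apply: computes_fdiv; [by []|nonzero|rounds (0 : R)].
  + by apply: computes_faddZ; try done; try pow2;
      [rounds (u / 4)|rounds (0 : R)].
  + by apply: computes_fsubZ; try done; try pow2;
      [rounds (0 : R)|rounds (0 : R)].
  + by apply: computes_finner; try done; try pow2; rounds (0 : R).
  + apply: computes_fdiv; [by []|nonzero|rounds (0 : R)].
  + by apply: computes_faddZ; try done; try pow2;
      [rounds (- (u / 4))|rounds (0 : R)].
Qed.

(** * The first two Lanczos steps *)

Lemma computes_lanczos2 (R : realType) (f : fp_format) (H : R) :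
    let u : R := 2 ^- prec f in let e := H^-1 ^+ 2 * u / 4 in
    (2 <= prec f)%N -> 0 < H -> pow2_or_0 H -> H^-1 ^+ 2 <= u / 4 ->
  computes f (lanczos f (mx2 e 0 0 1) (vec2 1 H) (vec2 0 0) 2)
    (LanczosState [:: 1; H^-1 ^+ 2] [:: H; H^-1; H^-1]
       (Some (vec2 (-1) 0, vec2 0 (-1)))).
Proof.
move=> u e p2 H_gt0 H2 h_le.
have u2 : pow2_or_0 u by apply/pow2_or_0V/pow2_or_0X.
have two2 : pow2_or_0 (2 : R) := pow2_or_0X R 1.
have four2 : pow2_or_0 (4 : R) by rewrite (_ : 4 = 2 ^+ 2 :> R); [pow2|ring].
have H0 : H != 0 by rewrite gt_eqF.
have h0 : H^-1 != 0 by rewrite invr_eq0.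
have u_gt0 : 0 < u by rewrite invr_gt0 exprn_gt0.
have u0 : u != 0 by rewrite gt_eqF.
have u_le1 : u <= 1 by rewrite invf_le1 ?exprn_gt0// exprn_ege1// ler1n.
have h_ge0 : 0 <= H^-1 ^+ 2 by rewrite sqr_ge0.
have [small0 small_h small_eh small_Ne small_u] :=
  small_perturbations (ltW u_gt0) u_le1 h_ge0 h_le.
have e2 : pow2_or_0 e by rewrite /e; pow2.
apply: (computes_bind (a := LanczosState [:: 1] [:: H; H^-1]
  (Some (vec2 H^-1 1, vec2 (-1) 0)))).
apply: (computes_bind (a := LanczosState [::] [:: H]
  (Some (0, vec2 H^-1 1)))).
- apply: (computes_bind (a := vec2 0 0)).
    by apply: computes_fmulmx_diag; try done; try pow2; algebra.
  apply: (computes_bind (a := vec2 1 H)).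
    by apply: computes_fsubv; [|rounds (0 : R)|rounds (0 : R)].
  apply: (computes_bind (a := H ^+ 2)).
    by apply: computes_finner; try done; try pow2; rounds (H^-1 ^+ 2).
  apply: (computes_bind (a := H)).
    by apply: computes_fsqrt => //; exact: ltW.
  rewrite (negPf H0); apply: (computes_bind (a := vec2 H^-1 1)) => //.
  by apply: computes_fdivv; [| |rounds (0 : R)|rounds (0 : R)].
(* The vector v_0 = 0 is put in component form for the componentwise lemmas. *)
- rewrite -vec2_00.
  apply: (@computes_lanczos_step _ _ _ [::] [:: H] _ _ (vec2 (e * H^-1) 1)
    (vec2 (e * H^-1) 1) (vec2 (- H^-1) 0) _ 1 (H^-1 ^+ 2)).
  + by apply: computes_fmulmx_diag; try done; try pow2; algebra.
  + by apply: computes_fsubZ; try done; try pow2;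
      [rounds (0 : R)|rounds (0 : R)].
  + by apply: computes_finner; try done; try pow2; rounds (e * H^-1 ^+ 2).
  + by apply: computes_fsubZ; try done; try pow2;
      [rounds (- e)|rounds (0 : R)].
  + by apply: computes_finner; try done; try pow2; rounds (0 : R).
  + by apply: computes_fsqrt => //; [rewrite invr_ge0 ltW | pow2].
  + by [].
  + by apply: computes_fdivv; [| |rounds (0 : R)|rounds (0 : R)].
(* The source of the singularity: the first entry -e - h^2 = -h^2 (1 + u/4) of w_2 is stored as
   -h^2, so alpha_2 is h^2 instead of h^2 + e. *)
- apply: (@computes_lanczos_step _ _ _ [:: 1] [:: H; H^-1] _ _ (vec2 (- e) 0)
    (vec2 (- H^-1 ^+ 2) (- H^-1)) (vec2 0 (- H^-1)) _ (H^-1 ^+ 2) (H^-1 ^+ 2)).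
  + by apply: computes_fmulmx_diag; try done; try pow2; algebra.
  + rewrite [last _ _]/=.
    by apply: computes_fsubZ; try done; try pow2;
      [rounds (u / 4)|rounds (0 : R)].
  + by apply: computes_finner; try done; try pow2; rounds (0 : R).
  + by apply: computes_fsubZ; try done; try pow2;
      [rounds (0 : R)|rounds (0 : R)].
  + by apply: computes_finner; try done; try pow2; rounds (0 : R).
  + by apply: computes_fsqrt => //; [rewrite invr_ge0 ltW | pow2].
  + by [].
  + by apply: computes_fdivv; [| |rounds (0 : R)|rounds (0 : R)].
Qed.

(** * Two-dimensional linear algebra *)

Lemma det_mx2 (R : realType) (a b c d : R) :
  \det (mx2 a b c d) = a * d - b * c.
Proof.
rewrite (expand_det_row _ 0) !big_ord_recl big_ord0 /cofactor !det_mx11 !mxE.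
by rewrite /=; ring.
Qed.

Lemma mul_mx2_vec2 (R : realType) (a b c d x y : R) :
  mx2 a b c d *m vec2 x y = vec2 (a * x + b * y) (c * x + d * y).
Proof.
by apply/colP => i; rewrite !mxE !big_ord_recl big_ord0 !mxE /= addr0; case: ifP.
Qed.

Lemma vec2_eta (R : realType) (y : 'cV[R]_2) : y = vec2 (y 0 0) (y 1 0).
Proof.
apply/colP => i; rewrite !mxE; case: ifP => [/eqP -> //|].
by case: i => [[|[|]]] // ? _; congr (y _ _); apply: val_inj.
Qed.

Lemma vec2_inj (R : realType) (a b c d : R) :
  vec2 a b = vec2 c d -> a = c /\ b = d.
Proof.
move=> E; split; first by rewrite -(vec2E a b).1 E vec2E.
by rewrite -(vec2E a b).2 E vec2E.
Qed.

Lemma spd_diag (R : realType) (d e : R) : 0 < d -> 0 < e -> spd (mx2 d 0 0 e).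
Proof.
move=> d0 e0; split.
  by apply/matrixP => i j; rewrite !mxE; case: ifP; case: ifP.
move=> x; rewrite [x]vec2_eta; set a := x 0 0; set b := x 1 0 => ab0.
rewrite -mulmxA mul_mx2_vec2 !mxE !big_ord_recl big_ord0 !mxE /= addr0.
rewrite !mul0r addr0 add0r !(mulrCA _ d) !(mulrCA _ e) -!expr2.
have da_ge0 : 0 <= d * a ^+ 2 by rewrite mulr_ge0 ?sqr_ge0// ltW.
have eb_ge0 : 0 <= e * b ^+ 2 by rewrite mulr_ge0 ?sqr_ge0// ltW.
have [a0|a0] := eqVneq a 0.
  have b0 : b != 0.
    apply: contra_neq ab0 => b0; rewrite a0 b0.
    by rewrite vec2_00.
  by rewrite ltr_wpDl// mulr_gt0// exprn_even_gt0.
by rewrite ltr_wpDr// mulr_gt0// exprn_even_gt0.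
Qed.

Theorem theorem3 (R : realType) (f : fp_format) (hp : (2 <= prec f)%N) :
  let p := prec f in
  let u : R := 2 ^- p in
  let s := uphalf (p + 2) in
  let H : R := 2 ^+ s in
  let h := H^-1 in
  let epsA := h ^+ 2 * u / 4 in
  let A := mx2 epsA 0 0 1 in
  let b := vec2 1 H in
  let x0 : 'cV[R]_2 := 0 in
  let e1 := vec2 1 0 in
  let cg4 := cg f A x0 b 4 in
  let lan2 := lanczos f A b x0 2 in
  (forall x, x \in exact_results cg4 -> x != 0 -> normal_finite f x) ->
  (forall x, x \in exact_results lan2 -> x != 0 -> normal_finite f x) ->
  spd A /\
  (exists2 st, stored cg4 = Some st &
     cg_x st = vec2 epsA^-1 H /\ vec2 epsA^-1 H = invmx A *m b) /\
  (exists2 st, stored lan2 = Some st &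
     [/\ size (lan_alpha st) = 2%N,
         (lan_beta st)`_0 = H,
         lanczos_T2 st = mx2 1 h h (h ^+ 2),
         lanczos_T2 st \notin unitmx
       & ~ exists y : 'cV[R]_2, lanczos_T2 st *m y = (lan_beta st)`_0 *: e1]).
Proof.
move=> p u s H h epsA A b x0 e1 cg4 lan2 cg_normal lan_normal.
have H_gt0 : 0 < H by rewrite exprn_gt0.
have H0 : H != 0 by rewrite gt_eqF.
have u_gt0 : 0 < u by rewrite invr_gt0 exprn_gt0.
(* The choice of s enters here: 2s >= p + 2, while u/4 = 2^-(p+2). *)
have h_le : h ^+ 2 <= u / 4.
  have -> : u / 4 = 2 ^- (p + 2) by rewrite /u exprD invfM expr2 -natrM.
  rewrite exprVn lef_pV2 ?posrE ?exprn_gt0// -exprM ler_eXn2l ?ltr1n//.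
  by rewrite /s; lia.
have eps_gt0 : 0 < epsA by rewrite !mulr_gt0 ?exprn_gt0 ?invr_gt0.
split; first exact: spd_diag.
split.
  have := computes_cg4 hp H_gt0 (pow2_or_0X _ _) h_le.
  rewrite vec2_00 => /(_ cg_normal) cg_stored.
  eexists; first exact: cg_stored.
  split=> //=; have A_unit : A \in unitmx.
    by rewrite unitmxE det_mx2 mulr0 subr0 mulr1 unitfE gt_eqF.
  (* Inserting A^-1 A on the left reduces the claim to A x = b, computed by components. *)
  rewrite -[LHS](mulKmx A_unit) mul_mx2_vec2.
  by rewrite divff ?gt_eqF// !mul0r addr0 add0r mul1r.
have := computes_lanczos2 hp H_gt0 (pow2_or_0X _ _) h_le.
rewrite vec2_00 => /(_ lan_normal) lan_stored.
eexists; first exact: lan_stored.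
rewrite /lanczos_T2 /=; split=> //.
  by rewrite unitmxE det_mx2 mul1r -expr2 subrr unitr0.
case=> y; rewrite [y]vec2_eta mul_mx2_vec2.
have -> : H *: e1 = vec2 H 0.
  by apply/colP => i; rewrite !mxE; case: ifP; rewrite ?mulr1 ?mulr0.
(* The second row of T_2 is h times the first, so a solution would force h H = 0, whereas h H =
   1. *)
move=> /vec2_inj[y1 y2]; have : h * H = 0.
  by rewrite -y1 -[RHS]y2 /h; ring.
by rewrite mulVf// => /eqP; rewrite oner_eq0.
Qed.
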